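(* Consider the Martinet flat sub-Riemannian structure on $\mathbb{M}=\mathbb{R}^3$ with coordinates $(x,y,z)=(x_1,x_2,x_3)$, with $$a^{\mathsf T}=\begin{pmatrix}1&0&\frac{y^2}{2}\\0&1&0\end{pmatrix},\qquad z^{\mathsf T}=(0,0,1),$$ a potential $V\in C^\infty(\mathbb{R}^3)$ and $\rho^*=\frac1ce^{-V}\mathrm{Vol}$ with $\mathrm{Vol}=e^{-y^2/2}$. Write $A_1f=\partial_xf+\frac{y^2}2\partial_zf$, $A_2f=\partial_yf$, $\mathsf Zf=\partial_zf$ and $\mathsf U=(A_1f,A_2f,\mathsf Zf)^{\mathsf T}$. Then for every $f\in C^\infty(\mathbb{M})$, $$\mathfrak R_{ab}^G(\nabla f,\nabla f)+\mathfrak R_{zb}(\nabla f,\nabla f)+\mathfrak R_{\rho^*}(\nabla f,\nabla f)=\mathsf U^{\mathsf T}\mathsf A\,\mathsf U,$$ where $\mathsf A$ is the symmetric $3\times3$ matrix function with entries $$\begin{aligned}\mathsf A_{11}&=\Big(\partial_x^2V+y^2\partial_x\partial_zV+\tfrac{y^4}{4}\partial_z^2V\Big)-y^2,\\ \mathsf A_{22}&=\partial_y^2V-y^2,\qquad \mathsf A_{33}=\tfrac{y^2}{2},\\ \mathsf A_{12}&=\mathsf A_{21}=\tfrac y2\partial_zV+\Big(\partial_x\partial_yV+\tfrac{y^2}{2}\partial_y\partial_zV\Big),\\ \mathsf A_{13}&=\mathsf A_{31}=\tfrac12-\tfrac y2\partial_yV+\tfrac12\Big(\partial_x\partial_zV+\tfrac{y^2}{2}\partial_z^2V\Big),\\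 \mathsf A_{23}&=\mathsf A_{32}=\tfrac12y\,A_1V+\tfrac12\partial_y\partial_zV.\end{aligned}$$
   Context: General notation (here $n=2$, $m=1$). $a$ is a smooth $3\times2$ matrix function and $z$ a smooth $3\times1$ matrix function on $\mathbb{R}^3$ (the matrix $z$ is not to be confused with the coordinate $z$). Write $\partial_p=\partial/\partial x_p$, $\alpha_{ip}=(a^{\mathsf T})_{ip}$, $\zeta_p=(z^{\mathsf T})_{1p}$; indices $i,k$ run over $\{1,2\}$ and $p,q,r,s$ over $\{1,2,3\}$; a derivative acts only on the factor immediately following it. $A_if=(a^{\mathsf T}\nabla)_if=\sum_p\alpha_{ip}\partial_pf$, $\mathsf Zf=(z^{\mathsf T}\nabla)_1f=\sum_p\zeta_p\partial_pf$. In $\rho^*=\frac1ce^{-V}\mathrm{Vol}$, $c=\int e^{-V}\mathrm{Vol}\,dx<\infty$ is the normalization constant. Matrices and vectors: pairs $(p,q)$ are ordered lexicographically. $Q\in\mathbb{R}^{4\times9}$ has entries $Q_{(i,k),(p,q)}=\alpha_{ip}\alpha_{kq}$ (rows $(i,k)$ in lexicographic order). $P\in\mathbb{R}^{2\times9}$ has entries $P_{k,(p,q)}=\zeta_p\alpha_{kq}$. $D\in\mathbb{R}^4$: $D_{ik}=\sum_{p,r}\alpha_{ip}\,\partial_p\alpha_{kr}\,\partial_rf$. $E\in\mathbb{R}^2$: $E_i=\sum_{p,r}\alpha_{ip}\,\partial_p\zeta_r\,\partial_rf$. For the Martinet structure, $$\Lambda_1^{\mathsf T}=\big(0,\tfrac{y\,\partial_zf}{2},0,\tfrac{y\,\partial_zf}{2},0,0,0,0,0\big),\qquad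 \Lambda_2^{\mathsf T}=\big(0,0,0,0,0,0,-y\,\partial_yf,\tfrac{y^3}{2}\partial_zf+y\,\partial_xf,0\big).$$ Tensors: $\mathfrak R^G_{ab}(\nabla f,\nabla f)=\mathfrak R_{ab}(\nabla f,\nabla f)-\Lambda_1^{\mathsf T}Q^{\mathsf T}Q\Lambda_1-\Lambda_2^{\mathsf T}P^{\mathsf T}P\Lambda_2+D^{\mathsf T}D+E^{\mathsf T}E$. Let $b=-\frac12aa^{\mathsf T}\nabla V$. Then $$\mathfrak R_{ab}(\nabla f,\nabla f)=\sum_{i,k}\sum_{p,q,r}\big[\alpha_{ip}\partial_p\alpha_{iq}\,\partial_q\alpha_{kr}\,\partial_rf+\alpha_{ip}\alpha_{iq}(\partial_p\partial_q\alpha_{kr})\partial_rf-\alpha_{kr}\partial_r\alpha_{ip}\,\partial_p\alpha_{iq}\,\partial_qf-\alpha_{kr}\alpha_{ip}(\partial_r\partial_p\alpha_{iq})\partial_qf\big]A_kf-2\sum_i\sum_{q,r}\big(\alpha_{iq}\partial_qb_r\,\partial_rf-b_r\partial_r\alpha_{iq}\,\partial_qf\big)A_if,$$ $$\mathfrak R_{zb}(\nabla f,\nabla f)=\sum_i\sum_{p,q,r}\big[\alpha_{ip}\partial_p\alpha_{iq}\,\partial_q\zeta_r\,\partial_rf+\alpha_{ip}\alpha_{iq}(\partial_p\partial_q\zeta_r)\partial_rf-\zeta_r\partial_r\alpha_{ip}\,\partial_p\alpha_{iq}\,\partial_qf-\zeta_r\alpha_{ip}(\partial_r\partial_p\alpha_{iq})\partial_qf\big]\mathsf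 Zf-2\sum_{q,r}\big(\zeta_q\partial_qb_r\,\partial_rf-b_r\partial_r\zeta_q\,\partial_qf\big)\mathsf Zf,$$ $$\begin{aligned}\mathfrak R_{\rho^*}(\nabla f,\nabla f)=&\ 2\sum_i\sum_{p,q,r,s}\big[(\partial_p\zeta_p)\zeta_q(\partial_q\alpha_{ir})\alpha_{is}+\zeta_p(\partial_p\zeta_q)(\partial_q\alpha_{ir})\alpha_{is}+\zeta_p\zeta_q(\partial_p\partial_q\alpha_{ir})\alpha_{is}+\zeta_p\zeta_q(\partial_q\alpha_{ir})(\partial_p\alpha_{is})\big]\partial_rf\,\partial_sf\\&+2\sum_i\sum_{q,r,s}(\mathsf Z\log\rho^* )\zeta_q(\partial_q\alpha_{ir})\alpha_{is}\,\partial_rf\,\partial_sf\\&-2\sum_i\sum_{p,q,r,s}\big[(\partial_p\alpha_{ip})\alpha_{iq}(\partial_q\zeta_r)\zeta_s+\alpha_{ip}(\partial_p\alpha_{iq})(\partial_q\zeta_r)\zeta_s+\alpha_{ip}\alpha_{iq}(\partial_p\partial_q\zeta_r)\zeta_s+\alpha_{ip}\alpha_{iq}(\partial_q\zeta_r)(\partial_p\zeta_s)\big]\partial_rf\,\partial_sf\\&-2\sum_i\sum_{q,r,s}(A_i\log\rho^* )\alpha_{iq}(\partial_q\zeta_r)\zeta_s\,\partial_rf\,\partial_sf.\end{aligned}$$ *)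

(* Defs.v *)
From mathcomp Require Import all_boot all_order all_algebra.
From mathcomp Require Import mxtens.
From mathcomp Require Import all_classical all_reals all_analysis.

Set Implicit Arguments.
Unset Strict Implicit.
Unset Printing Implicit Defensive.

Import Order.TTheory GRing.Theory Num.Theory.
Import numFieldNormedType.Exports.
Local Open Scope ring_scope.

Definition mx_of_rows {R : realType} (m n : nat) (s : seq (seq R)) : 'M[R]_(m, n) :=
  \matrix_(i < m, j < n) nth 0 (nth [::] s i) j.

Definition col_of_seq {R : realType} (n : nat) (s : seq R) : 'cV[R]_n :=
  \col_(i < n) s`_i.

Arguments mx_of_rows {R m n} s.
Arguments col_of_seq {R n} s.

Section Calculus.
Variable R : realType.
Implicit Types (p : 'I_3) (f : 'rV[R]_3 -> R).

Definition partial p f : 'rV[R]_3 -> R := fun x => 'D_(delta_mx 0 p) f x.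

Definition iter_partial (s : seq 'I_3) f : 'rV[R]_3 -> R := foldr partial f s.

(* Partial derivatives of all orders exist and are continuous; the case
   s = [::] covers f itself, and existence at each step is required because
   'D_v is a total operator. *)
Definition smooth f : Prop := forall s : seq 'I_3,
  continuous (iter_partial s f) /\
  forall p (x : 'rV[R]_3), derivable (iter_partial s f) x (delta_mx 0 p).

Definition grad f (x : 'rV[R]_3) : 'cV[R]_3 := \col_p partial p f x.

(* The library has no Lebesgue measure on 'rV[R]_3, so integrals over R^3 are
   taken over (R * R) * R with the product Lebesgue measure. *)
Definition point3 (w : (R * R) * R) : 'rV[R]_3 :=
  \row_(p < 3) [:: w.1.1; w.1.2; w.2]`_p.

Definition integral3 f : \bar R :=
  (\int[((@lebesgue_measure R \x @lebesgue_measure R) \x @lebesgue_measure R)%E]_w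
     (f (point3 w))%:E)%E.

End Calculus.

Section Tensors.
Variable R : realType.
Variables (a : 'rV[R]_3 -> 'M[R]_(3, 2)) (z : 'rV[R]_3 -> 'M[R]_(3, 1)).
Implicit Types (i k : 'I_2) (p q r s : 'I_3) (f : 'rV[R]_3 -> R) (x : 'rV[R]_3).

Definition alpha i p : 'rV[R]_3 -> R := fun x => (a x)^T i p.
Definition zeta p : 'rV[R]_3 -> R := fun x => (z x)^T 0 p.

Definition Ad i f x : R := \sum_p alpha i p x * partial p f x.
Definition Zd f x : R := \sum_p zeta p x * partial p f x.

(* tensmx orders pairs of indices lexicographically:
   Q (i, k) (p, q) = alpha i p * alpha k q, P k (p, q) = zeta p * alpha k q. *)
Definition Qmx x : 'M[R]_(2 * 2, 3 * 3) := (a x)^T *t (a x)^T.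
Definition Pmx x : 'M[R]_(1 * 2, 3 * 3) := (z x)^T *t (a x)^T.

Definition Dvec f x : 'cV[R]_(2 * 2) :=
  \col_u let: (i, k) := mxtens_unindex u in
    \sum_p \sum_r alpha i p x * partial p (alpha k r) x * partial r f x.

Definition Evec f x : 'cV[R]_2 :=
  \col_i \sum_p \sum_r alpha i p x * partial p (zeta r) x * partial r f x.

Definition drift (V : 'rV[R]_3 -> R) x : 'cV[R]_3 :=
  - (2^-1) *: (a x *m (a x)^T *m grad V x).

Section Rab_Rzb.
Variable b : 'rV[R]_3 -> 'cV[R]_3.
Let bc r : 'rV[R]_3 -> R := fun x => b x r 0.

Definition Rab f x : R :=
  \sum_i \sum_k (\sum_p \sum_q \sum_r
    (alpha i p x * partial p (alpha i q) x * partial q (alpha k r) x * partial r f x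
     + alpha i p x * alpha i q x * partial p (partial q (alpha k r)) x * partial r f x
     - alpha k r x * partial r (alpha i p) x * partial p (alpha i q) x * partial q f x
     - alpha k r x * alpha i p x * partial r (partial p (alpha i q)) x * partial q f x))
    * Ad k f x
  - 2 * \sum_i (\sum_q \sum_r
    (alpha i q x * partial q (bc r) x * partial r f x
     - bc r x * partial r (alpha i q) x * partial q f x)) * Ad i f x.

Definition Rzb f x : R :=
  \sum_i (\sum_p \sum_q \sum_r
    (alpha i p x * partial p (alpha i q) x * partial q (zeta r) x * partial r f x
     + alpha i p x * alpha i q x * partial p (partial q (zeta r)) x * partial r f x
     - zeta r x * partial r (alpha i p) x * partial p (alpha i q) x * partial q f x
     - zeta r x * alpha i p x * partial r (partial p (alpha i q)) x * partial q f x))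
    * Zd f x
  - 2 * (\sum_q \sum_r
    (zeta q x * partial q (bc r) x * partial r f x
     - bc r x * partial r (zeta q) x * partial q f x)) * Zd f x.

End Rab_Rzb.

Definition Rrho (rho : 'rV[R]_3 -> R) f x : R :=
  let log_rho := fun w => ln (rho w) in
  2 * (\sum_i \sum_p \sum_q \sum_r \sum_s
    (partial p (zeta p) x * zeta q x * partial q (alpha i r) x * alpha i s x
     + zeta p x * partial p (zeta q) x * partial q (alpha i r) x * alpha i s x
     + zeta p x * zeta q x * partial p (partial q (alpha i r)) x * alpha i s x
     + zeta p x * zeta q x * partial q (alpha i r) x * partial p (alpha i s) x)
    * partial r f x * partial s f x)
  + 2 * (\sum_i \sum_q \sum_r \sum_s
    Zd log_rho x * zeta q x * partial q (alpha i r) x * alpha i s x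
    * partial r f x * partial s f x)
  - 2 * (\sum_i \sum_p \sum_q \sum_r \sum_s
    (partial p (alpha i p) x * alpha i q x * partial q (zeta r) x * zeta s x
     + alpha i p x * partial p (alpha i q) x * partial q (zeta r) x * zeta s x
     + alpha i p x * alpha i q x * partial p (partial q (zeta r)) x * zeta s x
     + alpha i p x * alpha i q x * partial q (zeta r) x * partial p (zeta s) x)
    * partial r f x * partial s f x)
  - 2 * (\sum_i \sum_q \sum_r \sum_s
    Ad i log_rho x * alpha i q x * partial q (zeta r) x * zeta s x
    * partial r f x * partial s f x).

Definition RG (b : 'rV[R]_3 -> 'cV[R]_3)
    (L1 L2 : ('rV[R]_3 -> R) -> 'rV[R]_3 -> 'cV[R]_(3 * 3)) f x : R :=
  Rab b f x
  - ((L1 f x)^T *m (Qmx x)^T *m Qmx x *m L1 f x) 0 0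
  - ((L2 f x)^T *m (Pmx x)^T *m Pmx x *m L2 f x) 0 0
  + ((Dvec f x)^T *m Dvec f x) 0 0
  + ((Evec f x)^T *m Evec f x) 0 0.

End Tensors.

(* The coordinates x, y, z of R^3 are the entries 0, 1, 2 of a point. *)

Section Martinet.
Variable R : realType.
Implicit Types (f V : 'rV[R]_3 -> R) (x : 'rV[R]_3).

Local Notation dx := (partial (0 : 'I_3)).
Local Notation dy := (partial (1 : 'I_3)).
Local Notation dz := (partial (2 : 'I_3)).

Definition ycoord x : R := x 0 1.
Local Notation y := ycoord.

Definition martinet_a x : 'M[R]_(3, 2) :=
  (mx_of_rows [:: [:: 1; 0; y x ^+ 2 / 2];
                  [:: 0; 1; 0]] : 'M[R]_(2, 3))^T.

Definition martinet_z x : 'M[R]_(3, 1) := (mx_of_rows [:: [:: 0; 0; 1]] : 'M[R]_(1, 3))^T.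

Definition martinet_L1 f x : 'cV[R]_(3 * 3) :=
  col_of_seq [:: 0; y x * dz f x / 2; 0; y x * dz f x / 2; 0; 0; 0; 0; 0].

Definition martinet_L2 f x : 'cV[R]_(3 * 3) :=
  col_of_seq [:: 0; 0; 0; 0; 0; 0;
    - y x * dy f x; y x ^+ 3 / 2 * dz f x + y x * dx f x; 0].

Definition martinet_Vol x : R := expR (- (y x ^+ 2 / 2)).

Definition martinet_c V : \bar R :=
  integral3 (fun x => expR (- V x) * martinet_Vol x).

Definition martinet_rho V x : R :=
  (fine (martinet_c V))^-1 * expR (- V x) * martinet_Vol x.

Definition martinet_U f x : 'cV[R]_3 :=
  col_of_seq [:: Ad martinet_a 0 f x; Ad martinet_a 1 f x; Zd martinet_z f x].

Definition martinet_A V x : 'M[R]_3 :=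
  let A11 := (dx (dx V) x + y x ^+ 2 * dx (dz V) x + y x ^+ 4 / 4 * dz (dz V) x)
             - y x ^+ 2 in
  let A22 := dy (dy V) x - y x ^+ 2 in
  let A33 := y x ^+ 2 / 2 in
  let A12 := y x / 2 * dz V x + (dx (dy V) x + y x ^+ 2 / 2 * dy (dz V) x) in
  let A13 := 1 / 2 - y x / 2 * dy V x
             + 1 / 2 * (dx (dz V) x + y x ^+ 2 / 2 * dz (dz V) x) in
  let A23 := 1 / 2 * y x * Ad martinet_a 0 V x + 1 / 2 * dy (dz V) x in
  mx_of_rows [:: [:: A11; A12; A13];
                 [:: A12; A22; A23];
                 [:: A13; A23; A33]].

Lemma martinet_A1E f x :
  Ad martinet_a 0 f x = dx f x + y x ^+ 2 / 2 * dz f x.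
Proof.
rewrite /Ad !big_ord_recl big_ord0 /alpha /martinet_a !mxE /=.
rewrite mul1r mul0r add0r addr0; congr (partial _ f x + _ * partial _ f x);
exact: val_inj.
Qed.

Lemma martinet_A2E f x : Ad martinet_a 1 f x = dy f x.
Proof.
rewrite /Ad !big_ord_recl big_ord0 /alpha /martinet_a !mxE /=.
rewrite mul1r !mul0r add0r !addr0; congr (partial _ f x); exact: val_inj.
Qed.

Lemma martinet_ZE f x : Zd martinet_z f x = dz f x.
Proof.
rewrite /Zd !big_ord_recl big_ord0 /zeta /martinet_z !mxE /=.
rewrite mul1r !mul0r !add0r addr0; congr (partial _ f x); exact: val_inj.
Qed.

End Martinet.

(* Main.v *)
(* The horizontal coefficients depend on y only, through y^2/2, and [z] is
   constant.  Hence R_rho* vanishes identically, whatever the density, R_zb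
   reduces to its drift term, and the only drift-free contribution to R_ab is
   dz f * A1 f.  Expanding the derivatives of the drift -1/2 a a^T grad V leaves
   a polynomial identity between partial derivatives of f and V, once the mixed
   second derivatives of V are symmetrized by Schwarz's theorem: the second
   difference of V over a small parallelogram is, by two mean value theorems, a
   common multiple of nearby values of both mixed derivatives. *)

Require Import Defs.
From mathcomp Require Import all_boot all_order all_algebra.
From mathcomp Require Import mxtens ring.
From mathcomp Require Import all_classical all_reals all_analysis.
Import Order.TTheory GRing.Theory Num.Theory.
Import numFieldNormedType.Exports.
Local Open Scope ring_scope.

(** * Symmetry of mixed directional derivatives *)

Lemma is_derive_line (R : realType) (W : normedModType R) (f : W -> R)
    (x u : W) (s : R) : derivable f (x + s *: u) u ->
  is_derive s 1 (fun t : R => f (x + t *: u)) ('D_u f (x + s *: u)).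
Proof.
(* Both difference quotients are the same function of [h], so existence and value of the derivative
   transfer together. *)
have E : (fun h : R => h^-1 *:
     (((fun t : R => f (x + t *: u)) \o shift s) (h *: 1) - f (x + s *: u)))
   = (fun h => h^-1 *: ((f \o shift (x + s *: u)) (h *: u) - f (x + s *: u))).
  apply/funext => h /=; congr (_ *: (f _ - _)).
  by rewrite [h%R *: 1]mulr1 scalerDl addrCA.
by move=> df; apply: DeriveDef; rewrite /derivable /derive E.
Qed.

(** The left side is the increment over [[0, h]] of [t |-> f (x + h *: v + t *: u) - f (x + t *:
    u)]. The mean value theorem for this function gives [s]; applied next to ['D_u f] along [v] from
    [x + s *: u], it gives [t]. *)
Lemma second_difference (R : realType) (W : normedModType R) (f : W -> R)
    (x u v : W) (h : R) : 0 < h ->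
    (forall w, derivable f w u) -> (forall w, derivable ('D_u f) w v) ->
  exists s t, [/\ 0 < s < h, 0 < t < h &
    f (x + h *: u + h *: v) - f (x + h *: u) - f (x + h *: v) + f x =
    h ^+ 2 * 'D_v ('D_u f) (x + s *: u + t *: v)].
Proof.
move=> h0 fu fuv.
have derive_continuous (F G : R -> R) :
    (forall t : R, is_derive t 1 F (G t)) -> continuous F.
  move=> dF t; apply/differentiable_continuous/derivable1_diffP.
  by have [] := dF t.
have dg (s : R) : is_derive s 1
    (fun t : R => f (x + h *: v + t *: u) - f (x + t *: u))
    ('D_u f (x + h *: v + s *: u) - 'D_u f (x + s *: u)).
  by apply: is_deriveB; apply: is_derive_line.
have [s sh Es] := MVT h0 (fun s _ => dg s)
  (continuous_subspaceT (derive_continuous _ _ dg)).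
have dk (t : R) : is_derive t 1 (fun t : R => 'D_u f (x + s *: u + t *: v))
    ('D_v ('D_u f) (x + s *: u + t *: v)) by exact: is_derive_line.
have [t th Et] := MVT h0 (fun t _ => dk t)
  (continuous_subspaceT (derive_continuous _ _ dk)).
exists s, t; split; [by move: sh; rewrite in_itv|by move: th; rewrite in_itv|].
move: Es Et; rewrite !scale0r !addr0 !subr0 [x + s *: u + h *: v]addrAC.
rewrite [x + h *: v + h *: u]addrAC => Es Et.
move: Es; rewrite Et opprB addrA -mulrA -expr2 [LHS]addrAC [RHS]mulrC => <-.
by rewrite addrAC.
Qed.

Lemma derive_comm (R : realType) (W : normedModType R) (f : W -> R)
    (x u v : W) :
    (forall w, derivable f w u) -> (forall w, derivable f w v) ->
    (forall w, derivable ('D_u f) w v) -> (forall w, derivable ('D_v f) w u) ->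
    {for x, continuous ('D_v ('D_u f))} ->
    {for x, continuous ('D_u ('D_v f))} ->
  'D_v ('D_u f) x = 'D_u ('D_v f) x.
Proof.
move=> fu fv fuv fvu cuv cvu.
apply/eqP; rewrite -subr_eq0 -normr_le0; apply/ler_addgt0Pl => e e0.
rewrite addr0.
have e2 : 0 < e / 2 by rewrite divr_gt0.
move/cvgrPdist_lt : cuv => /(_ _ e2) /nbhs_normP[r1 /= r10 H1].
move/cvgrPdist_lt : cvu => /(_ _ e2) /nbhs_normP[r2 /= r20 H2].
have [r [r0 rr1 rr2]] : exists r, [/\ 0 < r, r <= r1 & r <= r2].
  by exists (Num.min r1 r2); rewrite lt_min r10 r20 !ge_min !lexx orbT.
(* The summand 1 keeps the divisor positive when [u] and [v] vanish, and makes the bound by [r] in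
   [near] strict. *)
have n0 : 0 < `|u| + `|v| + 1 by rewrite ltr_wpDl// addr_ge0.
have [h [h0 hr]] : exists h, 0 < h /\ h * (`|u| + `|v| + 1) = r.
  by exists (r / (`|u| + `|v| + 1)); rewrite divr_gt0// divfK// lt0r_neq0.
have near s t : 0 < s < h -> 0 < t < h -> `|x - (x + s *: u + t *: v)| < r.
  move=> /andP[s0 sh] /andP[t0 th].
  rewrite -addrA opprD addNKr normrN (le_lt_trans (ler_normD _ _))// !normrZ.
  rewrite !gtr0_norm// -hr !mulrDr mulr1.
  rewrite (le_lt_trans (lerD (ler_wpM2r _ (ltW sh)) (ler_wpM2r _ (ltW th))))//.
  by rewrite ltrDl.
have [s [t [sh th E1]]] := second_difference _ _ _ x u v _ h0 fu fuv.
have [s' [t' [sh' th' E2]]] := second_difference _ _ _ x v u _ h0 fv fvu.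
(* The second difference is symmetric in [u] and [v], so [E1] and [E2] have equal left sides, and
   [h ^+ 2] cancels. *)
have E :
    'D_v ('D_u f) (x + s *: u + t *: v) = 'D_u ('D_v f) (x + s' *: v + t' *: u).
  move: E2; rewrite [x + h *: v + h *: u]addrAC [_ - f (x + h *: u)]addrAC E1.
  by move/mulfI; apply; rewrite expf_neq0// gt_eqF.
have r1s := lt_le_trans (near _ _ sh th) rr1.
have := lt_le_trans (near _ _ th' sh') rr2.
rewrite [x + t' *: u + _]addrAC => r2s.
have /= D1 := H1 _ r1s; have /= D2 := H2 _ r2s.
(* Both mixed derivatives at [x] lie within [e / 2] of the common nearby value [M]. *)
move: ('D_v ('D_u f) x) ('D_u ('D_v f) x) E D1 D2 => A B <-.
move: ('D_v ('D_u f) _) => M D1 D2.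
rewrite (le_trans (ler_distD M _ _))// (splitr e) lerD ?(ltW D1)//.
by rewrite distrC ltW.
Qed.

(** * Sums over small index sets and squared norms *)

Lemma sum_ord2 (R : nmodType) (F : 'I_2 -> R) : \sum_i F i = F 0 + F 1.
Proof. by rewrite big_ord_recl big_ord1; congr (_ + F _); apply: val_inj. Qed.

Lemma sum_ord3 (R : nmodType) (F : 'I_3 -> R) : \sum_i F i = F 0 + F 1 + F 2.
Proof.
rewrite big_ord_recr sum_ord2 /=.
by congr (F _ + F _ + F _); apply: val_inj.
Qed.

Lemma sum_mxtens (R : nmodType) (m n : nat) (F : 'I_(m * n) -> R) :
  \sum_u F u = \sum_i \sum_j F (mxtens_index (i, j)).
Proof.
rewrite pair_big (reindex (@mxtens_index m n)).
  by apply: eq_bigr => -[].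
exists (@mxtens_unindex m n) => u _; first exact: mxtens_indexK.
exact: mxtens_unindexK.
Qed.

Lemma trmx_mul_self (R : comPzRingType) (n : nat) (w : 'cV[R]_n) :
  (w^T *m w) 0 0 = \sum_u w u 0 ^+ 2.
Proof. by rewrite mxE; apply: eq_bigr => u _; rewrite mxE expr2. Qed.

(** Turns the subtracted Lambda terms into squared norms, so that only the vectors [Q *m L1] and
    [P *m L2] have to be computed. *)
Lemma quadratic_form_tr_mul (R : comPzRingType) (m n : nat) (M : 'M[R]_(m, n))
    (w : 'cV[R]_n) :
  (w^T *m M^T *m M *m w) 0 0 = \sum_u (M *m w) u 0 ^+ 2.
Proof. by rewrite -trmx_mul -mulmxA trmx_mul_self. Qed.

(** * The Martinet coefficients and their derivatives *)

Section Martinet.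
Variable R : realType.
Implicit Types (f V : 'rV[R]_3 -> R) (x v : 'rV[R]_3).
Implicit Types (i k : 'I_2) (p q r : 'I_3).

Local Notation y := ycoord.
Local Notation al := (alpha (@martinet_a R)).
Local Notation ze := (zeta (@martinet_z R)).
Local Notation dx := (partial (0 : 'I_3)).
Local Notation dy := (partial (1 : 'I_3)).
Local Notation dz := (partial (2 : 'I_3)).

(** A coordinate is an entry of the identity map, and derivatives of matrix-valued maps are
    entrywise. *)
Lemma is_derive_coord x v q : is_derive x v (fun w : 'rV[R]_3 => w 0 q) (v 0 q).
Proof.
have dv : derivable (@id 'rV[R]_3) x v by exact: derivable_id.
apply: DeriveDef; first by move/derivable_mxP : dv => /(_ 0 q).
by have := derive_mx dv; rewrite derive_id => /matrixP/(_ 0 q); rewrite !mxE.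
Qed.

Lemma is_derive_ycoord x p : is_derive x (delta_mx 0 p) (@y R) (p == 1)%:R.
Proof.
apply: is_derive_eq; first exact: is_derive_coord.
by rewrite mxE eqxx eq_sym.
Qed.

Lemma partial_cst p (c : R) : partial p (fun=> c) = fun=> 0.
Proof. by apply/funext => x; exact: derive_cst. Qed.

(** One closed form for all entries turns the vanishing of a derivative into a boolean condition on
    indices. *)
Lemma alphaE i q :
  al i q = fun x =>
    (i == q :> nat)%:R + (y x ^+ 2 / 2) *+ ((i == 0) && (q == 2)).
Proof.
apply/funext => x; rewrite /alpha /martinet_a trmxK mxE.
by case: i q => [[|[|//]] ?] [[|[|[|//]]] ?]; rewrite /= ?addr0 ?add0r//.
Qed.

Lemma zetaE q : ze q = fun=> (q == 2)%:R.
Proof.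
apply/funext => x; rewrite /zeta /martinet_z trmxK mxE.
by case: q => [[|[|[|//]]] ?].
Qed.

Lemma partial_zeta p q : partial p (ze q) = fun=> 0.
Proof. by rewrite zetaE partial_cst. Qed.

Lemma is_derive_half_sq x p : is_derive x (delta_mx 0 p)
  (fun w : 'rV[R]_3 => y w ^+ 2 / 2) (y x *+ (p == 1)).
Proof.
have dy := is_derive_ycoord x p.
have -> : (fun w : 'rV[R]_3 => y w ^+ 2 / 2) = (2^-1 : R) \*: (@y R ^+ 2).
  by apply/funext => w /=; rewrite mulrC fctE.
apply: is_derive_eq.
by rewrite /GRing.scale /= -[RHS]mulr_natr expr1; field.
Qed.

Lemma partial_alpha p i q :
  partial p (al i q) = fun x => y x *+ [&& p == 1, i == 0 & q == 2].
Proof.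
rewrite alphaE; case: (_ && _) => /=; last first.
  rewrite andbF -(partial_cst p (i == q :> nat)%:R); congr partial.
  by apply/funext => x; rewrite addr0.
apply/funext => x; rewrite andbT.
have dq := is_derive_half_sq x p.
have dc := is_derive_cst ((i == q :> nat)%:R : R) x (delta_mx 0 p).
have [_ E] := is_deriveD dc dq.
by rewrite /partial E add0r.
Qed.

Lemma partial_partial_alpha p q i r x :
  partial p (partial q (al i r)) x = [&& p == 1, q == 1, i == 0 & r == 2]%:R.
Proof.
rewrite partial_alpha; case: [&& _, _ & _]; last first.
  by rewrite !andbF; apply: derive_cst.
by rewrite !andbT; case: (is_derive_ycoord x p).
Qed.

Lemma partial_comm f p q x : smooth f ->
  partial p (partial q f) x = partial q (partial p f) x.
Proof.
move=> sf; apply: derive_comm.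
- exact: (sf [::]).2.
- exact: (sf [::]).2.
- exact: (sf [:: q]).2.
- exact: (sf [:: p]).2.
- exact: (sf [:: p; q]).1.
- exact: (sf [:: q; p]).1.
Qed.

(** * The drift and its first derivatives *)

Lemma driftE V x r : drift (@martinet_a R) V x r 0 =
  - 2^-1 * \sum_i al i r x * Ad (@martinet_a R) i V x.
Proof.
rewrite /drift mxE; congr (_ * _); rewrite -mulmxA mxE.
apply: eq_bigr => i _; congr (_ * _); first by rewrite /alpha [RHS]mxE.
by rewrite mxE; apply: eq_bigr => p _; rewrite [grad _ _ _ _]mxE.
Qed.

(** The function is [A_1 V] written out; entries 0 and 2 of the drift are built from it. *)
Lemma is_derive_A1 V x p : smooth V -> is_derive x (delta_mx 0 p)
  (fun w => partial 0 V w + y w ^+ 2 / 2 * partial 2 V w)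
  (partial p (partial 0 V) x + y x ^+ 2 / 2 * partial p (partial 2 V) x
    + partial 2 V x * (y x *+ (p == 1))).
Proof.
move=> sV.
have dV q :
    is_derive x (delta_mx 0 p) (partial q V) (partial p (partial q V) x).
  exact: derivableP ((sV [:: q]).2 p x).
rewrite -addrA.
exact: is_deriveD (dV 0) (is_deriveM (is_derive_half_sq x p) (dV 2)).
Qed.

Lemma drift0E V x : drift (@martinet_a R) V x 0 0 =
  - 2^-1 * (partial 0 V x + y x ^+ 2 / 2 * partial 2 V x).
Proof.
by rewrite driftE sum_ord2 !alphaE /= !addr0 mul1r mul0r addr0 martinet_A1E.
Qed.

Lemma drift1E V x : drift (@martinet_a R) V x 1 0 = - 2^-1 * partial 1 V x.
Proof.
by rewrite driftE sum_ord2 !alphaE /= !addr0 mul0r add0r mul1r martinet_A2E.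
Qed.

Lemma drift2E V x : drift (@martinet_a R) V x 2 0 =
  - 2^-1 * (y x ^+ 2 / 2 * (partial 0 V x + y x ^+ 2 / 2 * partial 2 V x)).
Proof.
by rewrite driftE sum_ord2 !alphaE /= addr0 add0r mul0r addr0 martinet_A1E.
Qed.

Lemma partial_drift0 V x q : smooth V ->
  partial q (fun w => drift (@martinet_a R) V w 0 0) x =
  - 2^-1 * (partial q (partial 0 V) x + y x ^+ 2 / 2 * partial q (partial 2 V) x
    + partial 2 V x * (y x *+ (q == 1))).
Proof.
move=> sV; rewrite (_ : (fun w => _) = (- 2^-1 : R) \*:
    (fun w => partial 0 V w + y w ^+ 2 / 2 * partial 2 V w)).
  by have [_] := is_deriveZ (- 2^-1 : R) (is_derive_A1 V x q sV).
by apply/funext => w; rewrite drift0E.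
Qed.

Lemma partial_drift1 V x q : smooth V ->
  partial q (fun w => drift (@martinet_a R) V w 1 0) x =
  - 2^-1 * partial q (partial 1 V) x.
Proof.
move=> sV; rewrite (_ : (fun w => _) = (- 2^-1 : R) \*: partial 1 V).
  have dV := derivableP ((sV [:: 1]).2 q x).
  by have [_] := is_deriveZ (- 2^-1 : R) dV.
by apply/funext => w; rewrite drift1E.
Qed.

Lemma partial_drift2 V x q : smooth V ->
  partial q (fun w => drift (@martinet_a R) V w 2 0) x =
  - 2^-1 * (y x ^+ 2 / 2 *
      (partial q (partial 0 V) x + y x ^+ 2 / 2 * partial q (partial 2 V) x
       + partial 2 V x * (y x *+ (q == 1)))
    + (partial 0 V x + y x ^+ 2 / 2 * partial 2 V x) * (y x *+ (q == 1))).
Proof.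
move=> sV; rewrite (_ : (fun w => _) = (- 2^-1 : R) \*:
    ((fun w => y w ^+ 2 / 2)
     * (fun w => partial 0 V w + y w ^+ 2 / 2 * partial 2 V w))).
  have dA := is_deriveM (is_derive_half_sq x q) (is_derive_A1 V x q sV).
  by have [_] := is_deriveZ (- 2^-1 : R) dA.
by apply/funext => w; rewrite drift2E.
Qed.

(** * Vanishing of the density tensor *)

(** The first factor forces [q = 2], the second [q = 1]: the coefficients are constant along z. *)
Lemma zeta_partial_alpha q i r x : ze q x * partial q (al i r) x = 0.
Proof.
rewrite zetaE partial_alpha; case: (eqVneq q 2) => [->|_] /=; last exact: mul0r.
exact: mulr0.
Qed.

Lemma zeta_partial_partial_alpha p q i r x :
  ze q x * partial p (partial q (al i r)) x = 0.
Proof.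
rewrite zetaE partial_partial_alpha.
case: (eqVneq q 2) => [->|_]; last exact: mul0r.
by rewrite andbF mulr0.
Qed.

Lemma zeta_partial_partial_alpha_outer p q i r x :
  ze q x * partial q (partial p (al i r)) x = 0.
Proof.
rewrite zetaE partial_partial_alpha.
by case: (eqVneq q 2) => [->|_]; rewrite ?mulr0 ?mul0r.
Qed.

(** Each term of the first two groups contains a derivative of [zeta] or a derivative of [alpha]
    along [zeta]; each term of the last two contains a derivative of [zeta]. *)
Lemma Rrho_eq0 rho f x : Rrho (@martinet_a R) (@martinet_z R) rho f x = 0.
Proof.
rewrite /Rrho big1 => [|i _]; last first.
  rewrite big1 // => p _; rewrite big1 // => q _.
  rewrite big1 // => r _; rewrite big1 // => s _.
  rewrite !partial_zeta -!(mulrA _ (ze q x)) zeta_partial_partial_alpha.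
  by rewrite zeta_partial_alpha !(mulr0, mul0r, addr0).
rewrite big1 => [|i _]; last first.
  do 3![rewrite big1 // => ? _].
  by rewrite -(mulrA _ (ze _ x)) zeta_partial_alpha mulr0 !mul0r.
rewrite big1 => [|i _]; last first.
  do 4![rewrite big1 // => ? _].
  by rewrite !partial_zeta partial_cst !(mulr0, mul0r, addr0).
rewrite big1 => [|i _]; last first.
  do 3![rewrite big1 // => ? _].
  by rewrite !partial_zeta !(mulr0, mul0r).
by rewrite !(mulr0, subr0, addr0).
Qed.

(** * Squared norms of the Lambda, D and E terms *)

Lemma QmxE x (w : 'cV[R]_(3 * 3)) i k :
  (Qmx (@martinet_a R) x *m w) (mxtens_index (i, k)) 0 =
  \sum_p \sum_q al i p x * al k q x * w (mxtens_index (p, q)) 0.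
Proof.
rewrite mxE sum_mxtens; apply: eq_bigr => p _; apply: eq_bigr => q _.
by rewrite tensmxE.
Qed.

Lemma PmxE x (w : 'cV[R]_(3 * 3)) k :
  (Pmx (@martinet_a R) (@martinet_z R) x *m w) (mxtens_index (0, k)) 0 =
  \sum_p \sum_q ze p x * al k q x * w (mxtens_index (p, q)) 0.
Proof.
rewrite mxE sum_mxtens; apply: eq_bigr => p _; apply: eq_bigr => q _.
by rewrite tensmxE.
Qed.

(** The nonzero entries of [martinet_L1] sit at the pairs (0,1) and (1,0), and [Q] carries them to
    the rows with the same pairs. *)
Lemma Lambda1_sqnorm f x :
  ((martinet_L1 f x)^T *m (Qmx (@martinet_a R) x)^T *m Qmx (@martinet_a R) x
    *m martinet_L1 f x) 0 0 = (y x * partial 2 f x / 2) ^+ 2 *+ 2.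
Proof.
rewrite quadratic_form_tr_mul sum_mxtens !sum_ord2 !QmxE !sum_ord3 !alphaE.
rewrite /martinet_L1; move: (partial _ _ _) => fz; rewrite !mxE /=.
by field.
Qed.

Lemma Lambda2_sqnorm f x :
  ((martinet_L2 f x)^T *m (Pmx (@martinet_a R) (@martinet_z R) x)^T
    *m Pmx (@martinet_a R) (@martinet_z R) x *m martinet_L2 f x) 0 0 =
  (y x * partial 1 f x) ^+ 2
  + (y x ^+ 3 / 2 * partial 2 f x + y x * partial 0 f x) ^+ 2.
Proof.
rewrite quadratic_form_tr_mul sum_mxtens big_ord1 !sum_ord2 !PmxE !sum_ord3.
rewrite !alphaE !zetaE /martinet_L2.
(* Abstracting [partial], here and below, keeps [partial 0 f x] and
   [partial 1 f x] from being compared by unfolding the limits behind them. *)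
move: (@partial R) => d; rewrite !mxE /=.
by field.
Qed.

Lemma DvecE f x i k : Dvec (@martinet_a R) f x (mxtens_index (i, k)) 0 =
  \sum_p \sum_r al i p x * partial p (al k r) x * partial r f x.
Proof. by rewrite mxE mxtens_indexK. Qed.

(** Only the pair (1,0) contributes: [A_2] differentiates the entry [y ^+ 2 / 2] of the first
    row. *)
Lemma Dvec_sqnorm f x :
  ((Dvec (@martinet_a R) f x)^T *m Dvec (@martinet_a R) f x) 0 0 =
  (y x * partial 2 f x) ^+ 2.
Proof.
rewrite trmx_mul_self sum_mxtens !sum_ord2 !DvecE.
move: (@partial R) partial_alpha => d dalE.
rewrite !sum_ord3 !dalE !alphaE /=.
by field.
Qed.

Lemma Evec_sqnorm f x :
  ((Evec (@martinet_a R) (@martinet_z R) f x)^T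
    *m Evec (@martinet_a R) (@martinet_z R) f x) 0 0 = 0.
Proof.
rewrite trmx_mul_self big1 // => u _; rewrite mxE big1 ?expr0n// => p _.
by rewrite big1// => r _; rewrite partial_zeta mulr0 mul0r.
Qed.

(** * The tensors with drift *)

(** Z commutes with [A_1] and [A_2], so the drift bracket leaves [(Z A_1 V * A_1 f + Z A_2 V * A_2
    f) * Z f]. *)
Lemma RzbE V f x : smooth V ->
  Rzb (@martinet_a R) (@martinet_z R) (drift (@martinet_a R) V) f x =
  ((dz (dx V) x + y x ^+ 2 / 2 * dz (dz V) x) * (dx f x + y x ^+ 2 / 2 * dz f x)
   + dz (dy V) x * dy f x) * dz f x.
Proof.
move=> sV; rewrite /Rzb big1 ?sub0r => [|i _]; last first.
  rewrite big1 ?mul0r // => p _; rewrite big1 // => q _; rewrite big1 // => r _.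
  rewrite !partial_zeta partial_cst zeta_partial_alpha (mulrAC (ze r x)).
  by rewrite zeta_partial_partial_alpha_outer !(mulr0, mul0r, addr0, subr0).
have d0 q := partial_drift0 V x q sV.
have d1 q := partial_drift1 V x q sV.
have d2 q := partial_drift2 V x q sV.
rewrite martinet_ZE.
move: (@partial R) partial_zeta d0 d1 d2 => d dzeta d0 d1 d2.
rewrite !sum_ord3 !d0 !d1 !d2 !dzeta !zetaE /=.
by field.
Qed.

(** The first derivative needs [q = 2], the second [q = 1]. *)
Lemma partial_alpha_mul c p q r i k x :
  c * partial p (al i q) x * partial q (al k r) x = 0.
Proof.
rewrite !partial_alpha; case: (eqVneq q 2) => [->|_]; first by rewrite mulr0.
by rewrite !andbF mulr0 mul0r.
Qed.

(** The second derivative needs [p = 1] and [i = 0], where the entry [al 0 1] is zero. *)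
Lemma alpha_partial_partial_alpha c p q r i x :
  c * al i p x * partial r (partial p (al i q)) x = 0.
Proof.
rewrite partial_partial_alpha alphaE.
case: (eqVneq p 1) => [->|_]; last by rewrite andbF mulr0.
case: (eqVneq i 0) => [->|_]; last by rewrite !andbF mulr0.
by rewrite /= addr0 mulr0 mul0r.
Qed.

(* Only the term with two derivatives on [alpha] survives, for i = 1, k = 0. *)
Lemma Rab_second_order f x :
  \sum_i \sum_k (\sum_p \sum_q \sum_r
    (al i p x * partial p (al i q) x * partial q (al k r) x * partial r f x
     + al i p x * al i q x * partial p (partial q (al k r)) x * partial r f x
     - al k r x * partial r (al i p) x * partial p (al i q) x * partial q f x
     - al k r x * al i p x * partial r (partial p (al i q)) x * partial q f x))
    * Ad (@martinet_a R) k f x = dz f x * (dx f x + y x ^+ 2 / 2 * dz f x).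
Proof.
transitivity (\sum_i \sum_k (\sum_p \sum_q \sum_r
  al i p x * al i q x * partial p (partial q (al k r)) x * partial r f x)
    * Ad (@martinet_a R) k f x).
  apply: eq_bigr => i _; apply: eq_bigr => k _; congr (_ * _).
  apply: eq_bigr => p _; apply: eq_bigr => q _; apply: eq_bigr => r _.
  rewrite (partial_alpha_mul _ p q r i k) (partial_alpha_mul _ r p q i i).
  by rewrite alpha_partial_partial_alpha !mul0r add0r !subr0.
move: (@partial R) partial_partial_alpha (martinet_A1E f x)
  => d ddal A1E.
rewrite !sum_ord2 A1E !sum_ord3 !ddal /= !(mulr0, mul0r, addr0, add0r).
rewrite !alphaE /=.
by field.
Qed.

(** As a vector field, [-2 b] is the sum of [A_k V * A_k], so its bracket with [A_i] gives the terms
    [A_i A_k V * A_k f] and [A_k V * [A_i, A_k] f]. Since [[A_2, A_1]] is [y] times the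
    z-derivative, the latter are the two terms with [y x * dy V x] and [y x * (dx V x + ...)]. *)
Lemma RabE V f x : smooth V ->
  Rab (@martinet_a R) (drift (@martinet_a R) V) f x =
  (dz f x + (dx (dx V) x + y x ^+ 2 / 2 * dx (dz V) x
     + y x ^+ 2 / 2 * (dz (dx V) x + y x ^+ 2 / 2 * dz (dz V) x))
       * (dx f x + y x ^+ 2 / 2 * dz f x)
   + (dx (dy V) x + y x ^+ 2 / 2 * dz (dy V) x) * dy f x
   - y x * dy V x * dz f x) * (dx f x + y x ^+ 2 / 2 * dz f x)
  + ((dy (dx V) x + y x ^+ 2 / 2 * dy (dz V) x + y x * dz V x)
       * (dx f x + y x ^+ 2 / 2 * dz f x)
   + dy (dy V) x * dy f x
   + y x * (dx V x + y x ^+ 2 / 2 * dz V x) * dz f x) * dy f x.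
Proof.
move=> sV.
have d0 q := partial_drift0 V x q sV.
have d1 q := partial_drift1 V x q sV.
have d2 q := partial_drift2 V x q sV.
rewrite /Rab Rab_second_order.
move: (drift0E V x) (drift1E V x) (drift2E V x) d0 d1 d2.
move: (drift _ V) (@partial R) partial_alpha
  (martinet_A1E f x) (martinet_A2E f x).
move=> b d dal A1E A2E b0 b1 b2 d0 d1 d2.
rewrite !sum_ord2 A1E A2E !sum_ord3 b0 b1 b2 !d0 !d1 !d2 !dal !alphaE /=.
by field.
Qed.

End Martinet.

Theorem corollary4p8 (R : realType) (V : 'rV[R]_3 -> R) (hV : smooth V)
    (hc : (martinet_c V < +oo)%E) (f : 'rV[R]_3 -> R) (hf : smooth f)
    (x : 'rV[R]_3) :
  RG (@martinet_a R) (@martinet_z R) (drift (@martinet_a R) V)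
      (@martinet_L1 R) (@martinet_L2 R) f x
  + Rzb (@martinet_a R) (@martinet_z R) (drift (@martinet_a R) V) f x
  + Rrho (@martinet_a R) (@martinet_z R) (martinet_rho V) f x
  = ((martinet_U f x)^T *m martinet_A V x *m martinet_U f x) 0 0.
Proof.
(* The second Lambda term equals [y^2 ((A_1 f)^2 + (A_2 f)^2)], and D minus the first leaves
   [y^2 (Z f)^2 / 2]. With [Z f * A_1 f] from R_ab, these are the entries of the matrix free of
   [V]. *)
rewrite /RG Lambda1_sqnorm Lambda2_sqnorm Dvec_sqnorm Evec_sqnorm Rrho_eq0.
rewrite (RabE _ _ _ _ hV) (RzbE _ _ _ _ hV).
(* Oriented so that rewriting brings mixed derivatives of [V] to the order used in [martinet_A]. *)
have cxy := partial_comm _ V 1 0 x hV; have cxz := partial_comm _ V 2 0 x hV.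
have cyz := partial_comm _ V 2 1 x hV.
rewrite /martinet_U /martinet_A !martinet_A1E martinet_A2E martinet_ZE.
move: (@partial R) cxy cxz cyz => d cxy cxz cyz.
rewrite cxy cxz cyz mxE sum_ord3 !mxE !sum_ord3 !mxE /=.
by field.
Qed.
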